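(* Let $M=\mathbb{R}^n/\Gamma$ be a generalized Hantzsche-Wendt manifold. Then its fundamental group $\Gamma$ is diagonal; that is, the translation lattice $\Lambda$ of $\Gamma$ has an orthogonal $\mathbb{Z}$-basis in which the integral holonomy representation of $\Gamma$ is given by diagonal matrices.
   Context: $\mathrm{E}(n)=\mathrm{O}(n)\ltimes\mathbb{R}^n$ is the group of rigid motions of $\mathbb{R}^n$, with product $(B,b)(C,c)=(BC,Bc+b)$. A Bieberbach group of dimension (or rank) $n$ is a torsion-free, discrete, cocompact subgroup $\Gamma$ of $\mathrm{E}(n)$. Its translation subgroup $\Lambda=\{b:(Id,b)\in\Gamma\}\cong\mathbb{Z}^n$ is a lattice in $\mathbb{R}^n$, normal and of finite index in $\Gamma$. The finite group $G=\Gamma/\Lambda\cong\{B:(B,b)\in\Gamma\}$ is the holonomy group of $\Gamma$ (and of the flat manifold $\mathbb{R}^n/\Gamma$). The integral holonomy representation $\rho:G\to\mathrm{Aut}(\Lambda)\cong\mathrm{GL}(n,\mathbb{Z})$ is given by conjugation of $\Gamma$ on $\Lambda$, i.e. $(B,b)$ acts on $\Lambda$ by $\lambda\mapsto B\lambda$. A flat manifold $\mathbb{R}^n/\Gamma$ of dimension $n$ is called a generalized Hantzsche-Wendt (GHW) manifold if its holonomy group is isomorphic to $\mathbb{Z}_2^{\,n-1}$; then $\Gamma$ is called a GHW group. *)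

(* Defs.v *)
From HB Require Import structures.
From mathcomp Require Import all_boot all_order all_algebra all_fingroup.
From mathcomp Require Import generic_quotient.
From mathcomp Require Import all_classical all_reals all_analysis.

Set Implicit Arguments.
Unset Strict Implicit.
Unset Printing Implicit Defensive.

Import Order.TTheory GRing.Theory Num.Theory.
Import numFieldNormedType.Exports.

Local Open Scope classical_set_scope.
Local Open Scope ring_scope.

(* E(n): the pairs (B, b) with B orthogonal, acting on columns by
   x |-> B x + b. *)
Record rigid_motion (R : realType) (n : nat) := RigidMotion {
  rm_pair : 'M[R]_n * 'cV[R]_n;
  rm_orthogonal : rm_pair.1 *m rm_pair.1^T == 1%:M
}.

Section RigidMotion.
Context {R : realType} {n : nat}.
Notation E := (rigid_motion R n).

HB.instance Definition _ := [isSub for @rm_pair R n].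
HB.instance Definition _ := [Choice of E by <:].

Definition linear_part (x : E) : 'M[R]_n := (rm_pair x).1.
Definition translation_part (x : E) : 'cV[R]_n := (rm_pair x).2.

Lemma linear_partVr (x : E) : linear_part x *m (linear_part x)^T = 1%:M.
Proof. exact/eqP/rm_orthogonal. Qed.

Lemma linear_partVl (x : E) : (linear_part x)^T *m linear_part x = 1%:M.
Proof. exact/mulmx1C/linear_partVr. Qed.

Lemma rm_eq (x y : E) : linear_part x = linear_part y ->
  translation_part x = translation_part y -> x = y.
Proof.
move=> h1 h2; apply: val_inj.
rewrite [val x]surjective_pairing [val y]surjective_pairing.
by congr (_, _).
Qed.

Lemma rm_one_subproof :
  ((1%:M, 0) : 'M[R]_n * 'cV[R]_n).1 *m (1%:M, 0 : 'cV[R]_n).1^T == 1%:M.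
Proof. by rewrite /= trmx1 mulmx1. Qed.

Definition rm_one : E := RigidMotion rm_one_subproof.

Definition rm_mul_pair (x y : E) : 'M[R]_n * 'cV[R]_n :=
  (linear_part x *m linear_part y,
   linear_part x *m translation_part y + translation_part x).

Lemma rm_mul_subproof (x y : E) :
  (rm_mul_pair x y).1 *m (rm_mul_pair x y).1^T == 1%:M.
Proof.
by rewrite /= trmx_mul mulmxA -(mulmxA (linear_part x)) linear_partVr mulmx1
  linear_partVr.
Qed.

Definition rm_mul (x y : E) : E := RigidMotion (rm_mul_subproof x y).

Definition rm_inv_pair (x : E) : 'M[R]_n * 'cV[R]_n :=
  ((linear_part x)^T, - ((linear_part x)^T *m translation_part x)).

Lemma rm_inv_subproof (x : E) :
  (rm_inv_pair x).1 *m (rm_inv_pair x).1^T == 1%:M.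
Proof. by rewrite /= trmxK linear_partVl. Qed.

Definition rm_inv (x : E) : E := RigidMotion (rm_inv_subproof x).

Lemma rm_mulA : associative rm_mul.
Proof.
move=> x y z; apply: rm_eq; rewrite /linear_part /translation_part /=.
  by rewrite mulmxA.
by rewrite /translation_part /linear_part /= mulmxDr mulmxA addrA.
Qed.

Lemma rm_mul1 : left_id rm_one rm_mul.
Proof.
move=> x; apply: rm_eq; rewrite /linear_part /translation_part /=.
  by rewrite mul1mx.
by rewrite mul1mx addr0.
Qed.

Lemma rm_mulr1 : right_id rm_one rm_mul.
Proof.
move=> x; apply: rm_eq; rewrite /linear_part /translation_part /=.
  by rewrite mulmx1.
by rewrite mulmx0 add0r.
Qed.

Lemma rm_mulV : left_inverse rm_one rm_inv rm_mul.
Proof.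
move=> x; apply: rm_eq; first exact: linear_partVl.
by rewrite /translation_part /= subrr.
Qed.

Lemma rm_mulrV : right_inverse rm_one rm_inv rm_mul.
Proof.
move=> x; apply: rm_eq; first exact: linear_partVr.
rewrite /translation_part /= [translation_part _]/= mulmxN mulmxA.
by rewrite linear_partVr mul1mx addNr.
Qed.

HB.instance Definition _ := isGroup.Build E rm_mulA rm_mul1 rm_mulr1
  rm_mulV rm_mulrV.

HB.instance Definition _ := Topological.copy E (initial_topology (@rm_pair R n)).

Lemma translation_subproof (v : 'cV[R]_n) :
  ((1%:M, v) : 'M[R]_n * 'cV[R]_n).1 *m (1%:M, v).1^T == 1%:M.
Proof. by rewrite /= trmx1 mulmx1. Qed.

Definition translation (v : 'cV[R]_n) : E :=
  RigidMotion (translation_subproof v).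

Definition torsion_free (Gamma : set E) :=
  forall g k, Gamma g -> (0 < k)%N -> (g ^+ k = 1)%g -> g = 1%g.

Definition discrete_subset (Gamma : set E) := Gamma `<=` isolated Gamma.

(* E(n) / Gamma is the orbit space for left multiplication, as in R^n / Gamma;
   being in the same orbit is expressed as Gamma x = Gamma y, which is an
   equivalence relation for any set Gamma. *)
Definition orbit_set (Gamma : set E) (x : E) : set E :=
  [set (g * x)%g | g in Gamma].

Definition same_orbit (Gamma : set E) : rel E :=
  fun x y => `[< orbit_set Gamma x = orbit_set Gamma y >].

Lemma same_orbit_refl Gamma : reflexive (same_orbit Gamma).
Proof. by move=> x; apply/asboolP. Qed.

Lemma same_orbit_sym Gamma : symmetric (same_orbit Gamma).
Proof. by move=> x y; apply/asboolP/asboolP. Qed.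

Lemma same_orbit_trans Gamma : transitive (same_orbit Gamma).
Proof. by move=> y x z /asboolP xy /asboolP yz; apply/asboolP; rewrite xy. Qed.

Canonical same_orbit_equiv Gamma := EquivRel (same_orbit Gamma)
  (same_orbit_refl Gamma) (same_orbit_sym Gamma) (@same_orbit_trans Gamma).

Definition cocompact (Gamma : set E) :=
  compact [set: quotient_topology {eq_quot (same_orbit Gamma)}%qT].

Definition Bieberbach (Gamma : set E) :=
  [/\ group_closed (mem Gamma), torsion_free Gamma, discrete_subset Gamma
    & cocompact Gamma].

Definition translation_lattice (Gamma : set E) : set 'cV[R]_n :=
  [set v | Gamma (translation v)].

(* Gamma / Lambda, in the form {B : (B, b) in Gamma}, a group under *m. *)
Definition holonomy (Gamma : set E) : set 'M[R]_n := linear_part @` Gamma.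

(* Z_2 ^ k is the additive group of row vectors of length k over 'F_2. *)
Definition holonomy_isog_Z2 (Gamma : set E) (k : nat) :=
  exists phi : 'rV['F_2]_k -> 'M[R]_n,
    set_bij [set: 'rV['F_2]_k] (holonomy Gamma) phi /\
    {morph phi : u v / u + v >-> u *m v}.

Definition GHW (Gamma : set E) :=
  Bieberbach Gamma /\ holonomy_isog_Z2 Gamma n.-1.

(* c |-> \sum_i c_i e_i is a bijection of Z^n onto L. *)
Definition Zbasis (L : set 'cV[R]_n) (e : 'I_n -> 'cV[R]_n) :=
  set_bij [set: 'cV[int]_n] L (fun c => \sum_i (e i *~ c i 0)).

Definition orthogonal_family (e : 'I_n -> 'cV[R]_n) :=
  forall i j, i != j -> (e i)^T *m e j = 0.

(* Conjugation of the translation lattice, seen inside R^n. *)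
Definition conj_action (g : E) (v : 'cV[R]_n) : 'cV[R]_n :=
  translation_part (g * translation v * g^-1)%g.

Lemma translation_conj (g : E) v :
  (g * translation v * g^-1)%g = translation (linear_part g *m v).
Proof.
have gE : linear_part (g * translation v)%g = linear_part g by exact: mulmx1.
apply: rm_eq.
  by rewrite -[RHS](linear_partVr g) -{1}gE.
transitivity (linear_part (g * translation v)%g *m
    (- ((linear_part g)^T *m translation_part g)) +
    (linear_part g *m v + translation_part g)); first by [].
by rewrite gE mulmxN mulmxA linear_partVr mul1mx addrC addrK.
Qed.

Lemma conj_actionE (g : E) v : conj_action g v = linear_part g *m v.
Proof. by rewrite /conj_action translation_conj. Qed.

(* rho B is the matrix, in the Z-basis e of the translation lattice, of the
   action by conjugation of any element of Gamma with linear part B. *)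
Definition integral_holonomy_rep (Gamma : set E) (e : 'I_n -> 'cV[R]_n)
    (rho : 'M[R]_n -> 'M[int]_n) :=
  forall g, Gamma g -> forall j,
    conj_action g (e j) = \sum_i (e i *~ rho (linear_part g) i j).

Definition diagonal_group (Gamma : set E) :=
  exists e : 'I_n -> 'cV[R]_n,
    [/\ Zbasis (translation_lattice Gamma) e,
        orthogonal_family e
      & exists2 rho : 'M[R]_n -> 'M[int]_n,
          integral_holonomy_rep Gamma e rho
        & forall B, holonomy Gamma B -> is_diag_mx (rho B)].

End RigidMotion.

(* Main.v *)
Require Import Defs.
From mathcomp Require Import all_boot all_algebra.
From mathcomp Require Import all_classical all_reals all_analysis.
From mathcomp Require Import all_order generic_quotient.
From mathcomp Require Import ring lra.

(** Why a generalized Hantzsche-Wendt group is diagonal.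

    The holonomy group G is an elementary abelian 2-group of orthogonal
    matrices, so it consists of commuting symmetric involutions, which are sign
    matrices in a common eigenbasis ([holonomy_frame]).  An element of Gamma
    with linear part -1 would have trivial square, so -1 is not in G; since G
    has half as many elements as there are sign matrices, it contains exactly
    one of B and -B for each sign matrix B ([holonomy_reflection]).  For each
    axis i of the eigenbasis, G therefore contains either the reflection that
    negates only i or the opposite involution, which fixes only i.  Hence the
    axes are perpendicular.  Compactness makes the translation lattice Lambda
    span the space ([translation_lattice_spans]), so the projection of some
    lattice vector to axis i is not zero; twice that projection is in Lambda
    again, and by discreteness Lambda meets each axis in a group Z e_i with
    e_i nonzero ([axis_generator]).

    What is left is that the e_i generate Lambda ([lattice_integral]), and
    this is where freeness from torsion is used in full.  Coordinates of
    lattice vectors in the basis e are half-integers.  Call an axis unsplit if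
    some lattice vector has a non-integral coordinate there.  If a
    lattice vector cancels the translation part of an element of Gamma along its
    fixed axes, then the corrected element has trivial square, so its linear
    part is trivial.  This applies as soon as at most one of the fixed axes, say
    k, is unsplit and the translation part is integral on the others, because at
    k a half can be cancelled as well ([integral_fixed_part]).

    Suppose that k is unsplit.  Every axis l that is not the only fixed axis
    of some element carries an element r_l of Gamma whose linear part negates
    l alone; draw an arrow from l to p if the p-th translation coordinate of
    r_l is not an integer.  Let K be the set of axes from which arrows lead to
    an axis that is the only fixed axis of some element.  Following
    arrows backwards, in order of their distance, one finds for each p in K an
    element of Gamma that fixes p and otherwise only axes of K nearer than p,
    and whose translation part fails to be integral on its fixed axes at p
    only: composing with r_l, where l has an arrow to p, repairs p and moves
    the failure to l ([isolated_fixed_axis_step]).  The failure cannot move to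
    an unsplit axis, where it would be cancelled by a lattice vector, so K
    contains no unsplit axis.  No arrow enters K from outside
    ([closed_split_set]).  The product of the r_l over all l outside K other
    than k then fixes exactly k and the axes in K and is integral on K, so its
    linear part is trivial.  This is absurd, because no lattice vector is
    non-integral on one axis only, so that there is a second unsplit axis, and
    it is negated. *)

Set Implicit Arguments.
Unset Strict Implicit.
Unset Printing Implicit Defensive.

Import Order.TTheory GRing.Theory Num.Theory.
Import numFieldNormedType.Exports.

(** * Torsion-free groups of sign matrices with translations *)

Section HalfIntegers.
Local Open Scope ring_scope.

(** Both summands lie in Z + 1/2. *)
Lemma half_int_add (R : archiRealFieldType) (x y : R) :
  2 * x \is a Num.int -> 2 * y \is a Num.int ->
  x \isn't a Num.int -> y \isn't a Num.int -> x + y \is a Num.int.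
Proof.
have halfP (z : R) : 2 * z \is a Num.int -> z \isn't a Num.int ->
    z - 2^-1 \is a Num.int.
  case/intrP => k zk zN.
  have := divz_eq k 2; have := modz_ge0 k (isT : (2 : int) != 0).
  have := ltz_pmod k (isT : (0 < (2 : int))).
  case: (k %% 2)%Z => [[|[|r]]|r] // _ _ kE.
    case/negP: zN; suff -> : z = (k %/ 2)%Z%:~R by exact: intr_int.
    have : k%:~R = (k %/ 2)%Z%:~R * 2 :> R by rewrite {1}kE addr0 intrM.
    by lra.
  suff -> : z - 2^-1 = (k %/ 2)%Z%:~R by exact: intr_int.
  have : k%:~R = (k %/ 2)%Z%:~R * 2 + 1 :> R by rewrite {1}kE intrD intrM.
  by lra.
move=> x2 y2 xN yN.
have -> : x + y = (x - 2^-1) + (y - 2^-1) + 1 by lra.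
by apply: rpredD; [apply: rpredD; exact: halfP | exact: rpred1].
Qed.

End HalfIntegers.

Section DiagonalGroups.
Import mathcomp.boot.fintype mathcomp.boot.finset.
Local Open Scope ring_scope.

Definition symdiff n (N M : {set 'I_n}) : {set 'I_n} :=
  [set i | (i \in N) (+) (i \in M)].

Definition sign_at (R : archiRealFieldType) n (N : {set 'I_n}) (i : 'I_n) : R :=
  (-1) ^+ (i \in N).

(** A subgroup of E(n) with diagonal linear parts, in coordinates: [H N b] says
    that the motion that negates the coordinates in [N] and then translates by
    [b] is in the group, so [H set0] is the translation lattice.  [diag_int] and
    [diag_axis] normalize the coordinates: the lattice meets each axis in the
    multiples of the unit vector.  [diag_fixed] is freeness from torsion, since
    a motion with no translation along its fixed axes has trivial square. *)
Record diagonal_torsion_free (R : archiRealFieldType) (n : nat)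
    (H : {set 'I_n} -> ('I_n -> R) -> Prop) : Prop := DiagonalTorsionFree {
  diag_mul : forall N b M c, H N b -> H M c ->
    H (symdiff N M) (fun i => sign_at R N i * c i + b i);
  diag_inv : forall N b, H N b -> H N (fun i => - (sign_at R N i * b i));
  diag_int : forall v, (forall i, v i \is a Num.int) -> H set0 v;
  diag_axis : forall v i, H set0 v -> (forall j, j != i -> v j = 0) ->
    v i \is a Num.int;
  diag_reflection : forall i,
    (exists b, H [set i] b) \/ (exists b, H (~: [set i]) b);
  diag_fixed : forall N b, H N b -> (forall i, i \notin N -> b i = 0) ->
    N = set0 }.

Variables (R : archiRealFieldType) (n : nat).
Variable H : {set 'I_n} -> ('I_n -> R) -> Prop.
Hypothesis diagH : diagonal_torsion_free H.

Notation lattice := (H set0).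

Lemma symdiff0 (N : {set 'I_n}) : symdiff set0 N = N.
Proof. by apply/setP => i; rewrite !inE. Qed.

Lemma symdiffxx (N : {set 'I_n}) : symdiff N N = set0.
Proof. by apply/setP => i; rewrite !inE addbb. Qed.

Lemma sign_at_in (N : {set 'I_n}) i : i \in N -> sign_at R N i = -1.
Proof. by rewrite /sign_at => ->. Qed.

Lemma sign_at_notin (N : {set 'I_n}) i : i \notin N -> sign_at R N i = 1.
Proof. by rewrite /sign_at => /negbTE ->. Qed.

Lemma translate N b v : lattice v -> H N b -> H N (fun i => b i + v i).
Proof.
move=> Lv Hb; have := diag_mul diagH Lv Hb; rewrite symdiff0.
by congr (H N _); apply: funext => i; rewrite sign_at_notin ?inE ?mul1r.
Qed.

Lemma lattice_opp v : lattice v -> lattice (fun i => - v i).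
Proof.
move=> /(diag_inv diagH); congr (H _ _); apply: funext => i.
by rewrite sign_at_notin ?inE ?mul1r.
Qed.

(** Conjugation by a group element acts on the lattice by its linear part. *)
Lemma lattice_sign N b v : H N b -> lattice v ->
  lattice (fun i => sign_at R N i * v i).
Proof.
move=> Hb Lv; have := diag_mul diagH Hb Lv.
move=> /(diag_mul diagH)/(_ (diag_inv diagH Hb)).
have -> : symdiff N set0 = N by apply/setP => i; rewrite !inE addbF.
rewrite symdiffxx; congr (H _ _); apply: funext => i.
by case: (boolP (i \in N)) => iN; rewrite ?(sign_at_in iN) ?(sign_at_notin iN); ring.
Qed.

(** The square of a group element is a translation. *)
Lemma lattice_square N b : H N b -> lattice (fun i => (1 + sign_at R N i) * b i).
Proof.
move=> Hb; have := diag_mul diagH Hb Hb; rewrite symdiffxx.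
by congr (H _ _); apply: funext => i; ring.
Qed.

Lemma lattice_axis v i : lattice v ->
  (forall j, j != i -> v j \is a Num.int) -> v i \is a Num.int.
Proof.
move=> Lv vZ; pose w j := if j == i then 0 else - v j.
have Lw : lattice w.
  apply: (diag_int diagH) => j; rewrite /w; case: eqVneq => // /vZ ?.
  by rewrite rpredN.
have := diag_axis diagH (translate Lw Lv) (i := i).
by rewrite /w eqxx addr0; apply => j /negbTE ->; rewrite subrr.
Qed.

(** If [B] negates only axis [i], then [v - B v] is twice the projection of [v]
    to that axis; if [B] fixes only axis [i], then [v + B v] is. *)
Lemma lattice_half v i : lattice v -> 2 * v i \is a Num.int.
Proof.
move=> Lv; case: (diag_reflection diagH i) => -[b Hb].
- have := translate (lattice_opp (lattice_sign Hb Lv)) Lv.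
  move=> /(diag_axis diagH (i := i)) /=; rewrite sign_at_in ?inE //.
  rewrite -[v i - _](_ : 2 * v i = _); last by ring.
  apply=> j ji; rewrite sign_at_notin ?inE //; ring.
- have := translate (lattice_sign Hb Lv) Lv.
  move=> /(diag_axis diagH (i := i)) /=; rewrite sign_at_notin ?inE ?eqxx //.
  rewrite -[v i + _](_ : 2 * v i = _); last by ring.
  apply=> j ji; rewrite sign_at_in ?inE //; ring.
Qed.

Definition fixes_only_axis (i : 'I_n) : Prop := exists b, H (~: [set i]) b.

(** The axes that obstruct the splitting of the lattice into its intersections
    with the axes; the aim is to show that there are none. *)
Definition unsplit : {set 'I_n} :=
  [set i | `[< exists2 v, lattice v & v i \isn't a Num.int >]].

Lemma unsplitP i : reflect (exists2 v, lattice v & v i \isn't a Num.int) (i \in unsplit).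
Proof. by rewrite inE; exact: asboolP. Qed.

Lemma lattice_split v i : i \notin unsplit -> lattice v -> v i \is a Num.int.
Proof. by move=> iU Lv; apply: contraNT iU => vi; apply/unsplitP; exists v. Qed.

(** A vector that is non-integral on a single axis would give, after an integral
    correction, a fraction of the shortest lattice vector on that axis. *)
Lemma unsplit_other i : i \in unsplit -> exists2 j, j != i & j \in unsplit.
Proof.
case/unsplitP => v Lv vi; apply: contrapT => nj; case/negP: vi.
apply: lattice_axis => // j ji; apply: lattice_split => //.
by apply/negP => jU; apply: nj; exists j.
Qed.

Lemma fixed_half N b i : H N b -> i \notin N -> i \notin unsplit ->
  2 * b i \is a Num.int.
Proof.
move=> Hb iN iU; have := lattice_split iU (lattice_square Hb).
by rewrite sign_at_notin.
Qed.

(** The form in which freeness from torsion is used throughout.  The square of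
    the motion shows that its translation along [k] is a half-integer; if it is
    not an integer, a lattice vector that witnesses that [k] is unsplit makes it
    one, without spoiling integrality on the other fixed axes as these are
    split.  An integral vector then removes the translation along all fixed
    axes. *)
Lemma integral_fixed_part N b k : H N b -> k \in unsplit ->
  (forall i, i \notin N -> i != k -> i \notin unsplit /\ b i \is a Num.int) ->
  N = set0.
Proof.
move=> Hb kU bZ.
have [v Lv vk] : exists2 v, lattice v &
    k \notin N -> b k + v k \is a Num.int.
  have [kN|kN] := boolP (k \in N).
    by exists (fun=> 0) => //; apply: (diag_int diagH).
  have b2 : 2 * b k \is a Num.int.
    have := @lattice_axis _ k (lattice_square Hb); rewrite sign_at_notin //; apply.
    move=> i ik; have [iN|iN] := boolP (i \in N).
      by rewrite sign_at_in // subrr mul0r.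
    have [_ bi] := bZ i iN ik; rewrite sign_at_notin //.
    by apply: rpredM => //; apply: rpredD; apply: rpred1.
  have [bk|bk] := boolP (b k \is a Num.int).
    exists (fun=> 0) => [|_]; last by rewrite addr0.
    exact: (diag_int diagH).
  case/unsplitP: kU => v Lv vk; exists v => // _.
  by apply: half_int_add => //; apply: lattice_half.
(* Translations along negated axes do not matter for torsion. *)
pose w i := if i \in N then 0 else - (b i + v i).
have Lw : lattice w.
  apply: (diag_int diagH) => i; rewrite /w; case: ifPn => // iN; rewrite rpredN.
  have [ik|ik] := eqVneq i k; first by rewrite ik; apply: vk; rewrite -ik.
  have [iU bi] := bZ i iN ik; by apply: rpredD => //; exact: lattice_split Lv.
apply: (diag_fixed diagH (translate Lw (translate Lv Hb))) => i iN.
by rewrite /w (negbTE iN) subrr.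
Qed.

(** A translation along the only fixed axis cannot be cancelled, not even with
    the help of a lattice vector that is half-integral there. *)
Lemma fixes_only_axis_split i b : H (~: [set i]) b -> i \notin unsplit.
Proof.
move=> Hb; apply/negP => iU.
have [j ji jU] := unsplit_other iU.
have /setP/(_ j) : ~: [set i] = set0.
  by apply: (integral_fixed_part Hb iU) => k; rewrite in_setC in_set1 negbK => ->.
by rewrite !inE ji.
Qed.

(** Witnesses for the growth of the set of split axes: among the fixed axes of
    some motion, [p] is the only one along which its translation is not
    integral, and the others belong to [K]. *)
Definition isolated_fixed_axis (K : {set 'I_n}) (p : 'I_n) : Prop :=
  exists N b, [/\ H N b, p \notin N, b p \isn't a Num.int &
    forall i, i \notin N -> i != p -> i \in K /\ b i \is a Num.int].

(** [r l] is the translation part of a motion that negates only axis [l].  The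
    sets [K0] and [K1] are consecutive stages of the growth, so that the axis
    [p] with [r l p] not integral belongs to the last layer [K1 :\: K0].
    Composing the motion isolating [p] with that of [l] adds [l] to the fixed
    axes.  It turns the half-integer at [p] into an integer, and it changes the
    other fixed axes by integers because they lie in [K0], where [l] has no
    non-integral translation.  If the new motion were integral at [l], or if [l]
    were unsplit, it would be torsion; but it still negates an unsplit axis. *)
Lemma isolated_fixed_axis_step (r : 'I_n -> 'I_n -> R) (K0 K1 : {set 'I_n}) k :
  (forall i, ~ fixes_only_axis i -> H [set i] (r i)) ->
  k \in unsplit -> K0 \subset K1 ->
  (forall i, fixes_only_axis i -> i \in K1) ->
  (forall i, i \in K1 -> i \notin unsplit) ->
  (forall l p, l \notin K1 -> p \in K0 -> r l p \is a Num.int) ->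
  (forall p, p \in K1 -> p \notin K0 -> isolated_fixed_axis K0 p) ->
  forall l p, l \notin K1 -> p \in K1 -> r l p \isn't a Num.int ->
    l \notin unsplit /\ isolated_fixed_axis K1 l.
Proof.
move=> Hr kU K01 SK KU noedge iso l p lK pK rlp.
have pK0 : p \notin K0 by apply: contra rlp => /(noedge _ _ lK).
have [N [b [Hb pN bp bZ]]] := iso p pK pK0.
have Hrl : H [set l] (r l) by apply: Hr => /SK; rewrite (negbTE lK).
have FK i : i \notin N -> i \in K1.
  by have [-> //|ip iN] := eqVneq i p; apply: (subsetP K01); case: (bZ i iN ip).
have lN : l \in N by apply: contraNT lK; apply: FK.
have lp : p != l by apply: contraNneq lK => <-.
pose M := symdiff [set l] N.
have inM i : i != l -> (i \in M) = (i \in N) by move=> /negbTE il; rewrite !inE il.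
pose c i := sign_at R [set l] i * b i + r l i.
have Hc : H M c by exact: (diag_mul diagH Hrl Hb).
have cE i : i != l -> c i = b i + r l i.
  by move=> il; rewrite /c sign_at_notin ?mul1r // inE.
have cZ i : i \notin M -> i != l -> i \in K1 /\ c i \is a Num.int.
  move=> iM il; rewrite inM // in iM; split; first exact: FK.
  have iU : i \notin unsplit by apply/KU/FK.
  rewrite cE //; have [ip|ip] := eqVneq i p.
    rewrite ip in iM iU il *; apply: half_int_add => //.
      exact: fixed_half Hb _ _.
    by apply: fixed_half Hrl _ _ => //; rewrite inE.
  have [iK bi] := bZ i iM ip; apply: rpredD => //; exact: noedge.
have UM j : j \in unsplit -> j != l -> j \in M.
  move=> jU jl; rewrite inM //; apply: contraLR jU => /FK; exact: KU.
have lU : l \notin unsplit.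
  apply/negP => lU; have [j jl jU] := unsplit_other lU.
  have M0 : M = set0.
    apply: (integral_fixed_part Hc lU) => i iM il.
    by have [/KU iU ci] := cZ i iM il.
  by have := UM j jU jl; rewrite M0 inE.
split=> //; exists M, c; split=> //; first by rewrite !inE eqxx lN.
apply/negP => cl.
have M0 : M = set0.
  apply: (integral_fixed_part Hc kU) => i iM ik.
  have [-> //|il] := eqVneq i l; have [/KU iU ci] := cZ i iM il; by split.
have kl : k != l by apply: contraNneq lU => <-.
by have := UM k kU kl; rewrite M0 inE.
Qed.

(** The growth starts from the axes that are the only fixed axis of a motion;
    each layer adds the axes whose reflecting motion has a non-integral
    translation along some axis reached before. *)
Lemma closed_split_set (r : 'I_n -> 'I_n -> R) k :
  (forall i, ~ fixes_only_axis i -> H [set i] (r i)) -> k \in unsplit ->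
  exists K : {set 'I_n},
    [/\ forall i, fixes_only_axis i -> i \in K,
        forall i, i \in K -> i \notin unsplit &
        forall l p, l \notin K -> p \in K -> r l p \is a Num.int].
Proof.
move=> Hr kU.
suff grow m (K0 K1 : {set 'I_n}) : (#|~: K1| <= m)%N -> K0 \subset K1 ->
    (forall i, fixes_only_axis i -> i \in K1) ->
    (forall i, i \in K1 -> i \notin unsplit) ->
    (forall l p, l \notin K1 -> p \in K0 -> r l p \is a Num.int) ->
    (forall p, p \in K1 -> p \notin K0 -> isolated_fixed_axis K0 p) ->
    exists K : {set 'I_n}, [/\ forall i, fixes_only_axis i -> i \in K,
      forall i, i \in K -> i \notin unsplit &
      forall l p, l \notin K -> p \in K -> r l p \is a Num.int].
  apply: (grow _ set0 [set i | `[< fixes_only_axis i >]]) (leqnn _) _ _ _ _ _.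
  - exact: sub0set.
  - by move=> i ci; rewrite inE; apply/asboolP.
  - by move=> i; rewrite inE => /asboolP [b /fixes_only_axis_split].
  - by move=> l p _; rewrite inE.
  move=> p; rewrite inE => /asboolP [b Hb] _; exists (~: [set p]), b; split=> //.
  - by rewrite !inE eqxx.
  - apply/negP => bp; have pU := fixes_only_axis_split Hb.
    have kp : k != p by apply: contraNneq pU => <-.
    have /setP/(_ k) : ~: [set p] = set0.
      apply: (integral_fixed_part Hb kU) => i; rewrite !inE negbK => /eqP -> _.
      by split=> //; rewrite inE in pU.
    by rewrite !inE kp.
  by move=> i; rewrite !inE negbK => /eqP ->; rewrite eqxx.
elim: m K0 K1 => [|m IHm] K0 K1 Km K01 SK KU noedge iso.
  exists K1; split=> // l p lK; move: Km; rewrite leqn0 cards_eq0 => /eqP/setP/(_ l).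
  by rewrite !inE lK.
pose new := [set l | (l \notin K1) && [exists p in K1, r l p \isn't a Num.int]].
have step l : l \in new -> l \notin unsplit /\ isolated_fixed_axis K1 l.
  rewrite inE => /andP[lK /existsP[p /andP[pK rlp]]].
  exact: (isolated_fixed_axis_step Hr kU K01 SK KU noedge iso lK pK rlp).
have oldedge l p : l \notin K1 :|: new -> p \in K1 -> r l p \is a Num.int.
  rewrite !inE negb_or => /andP[lK]; rewrite lK /= negb_exists => /forallP/(_ p).
  by rewrite negb_and negbK => /orP[/negbTE->|].
have [new0|/set0Pn[l0 l0new]] := eqVneq new set0.
  by exists K1; split=> // l p lK pK; apply: oldedge => //; rewrite new0 setU0.
apply: (IHm K1 (K1 :|: new)) => //.
- rewrite -ltnS; apply: leq_trans Km; apply: proper_card; apply/properP; split.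
    by rewrite setCS subsetUl.
  exists l0; first by move: l0new; rewrite !inE => /andP[].
  by rewrite inE negbK inE l0new orbT.
- exact: subsetUl.
- by move=> i /SK iK; rewrite inE iK.
- by move=> i; rewrite inE => /orP[/KU//|/step[]].
by move=> p; rewrite inE => /orP[-> //|/step[]].
Qed.

(** With [K] as in [closed_split_set] and an unsplit axis [i], the product of the
    reflecting motions of all axes outside [K] other than [i] fixes exactly [i]
    and the axes in [K], and its translation is integral on [K]; so it is the
    identity.  This is absurd because a second unsplit axis is negated. *)
Theorem lattice_integral v i : lattice v -> v i \is a Num.int.
Proof.
move=> Lv; apply: contrapT => /negP vi.
have kU : i \in unsplit by apply/unsplitP; exists v.
have reflections j : exists b, ~ fixes_only_axis j -> H [set j] b.
  case: (diag_reflection diagH j) => [[b Hb]|cj]; first by exists b.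
  by exists (fun=> 0).
have [r Hr] := choice reflections.
have [K [SK KU noedge]] := closed_split_set Hr kU.
have prodr m (A : {set 'I_n}) : #|A| = m -> [disjoint A & K] ->
    exists2 b, H A b & forall p, p \in K -> b p \is a Num.int.
  elim: m A => [|m IHm] A.
    move/eqP; rewrite cards_eq0 => /eqP -> _; exists (fun=> 0) => //.
    exact: (diag_int diagH).
  move=> Am AK; have [l lA] : exists l, l \in A by apply/card_gt0P; rewrite Am.
  have lK : l \notin K by rewrite (disjointFr AK).
  have Alm : #|A :\ l| = m by move: Am; rewrite (cardsD1 l) lA => -[].
  have [b Hb bZ] := IHm _ Alm (disjointWl (subD1set A l) AK).
  have Hrl : H [set l] (r l) by apply: Hr => /SK; rewrite (negbTE lK).
  exists (fun j => sign_at R [set l] j * b j + r l j).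
    have -> : A = symdiff [set l] (A :\ l).
      by apply/setP => j; rewrite !inE; case: eqVneq => [->|]; rewrite ?lA.
    exact: (diag_mul diagH Hrl Hb).
  move=> p pK; rewrite sign_at_notin ?mul1r; last first.
    by rewrite inE; apply: contraNneq lK => <-.
  by apply: rpredD; [exact: bZ | exact: noedge].
have [j ji jU] := unsplit_other kU.
have [|b Hb bZ] := prodr _ ((~: K) :\ i) erefl.
  rewrite -setI_eq0; apply/eqP/setP => p; rewrite !inE.
  by case: (p \in K); rewrite ?andbF.
have /setP/(_ j) : (~: K) :\ i = set0.
  apply: (integral_fixed_part Hb kU) => p; rewrite !inE negb_and !negbK.
  by move=> /orP[->//|pK] _; split; [have := KU p pK; rewrite inE | exact: bZ].
rewrite !inE ji /=; case: (boolP (j \in K)) => // /KU; by rewrite jU.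
Qed.

End DiagonalGroups.

(** * The translation lattice of a discrete cocompact group *)

Section RigidMotionGroups.
Local Open Scope classical_set_scope.
Local Open Scope ring_scope.
Variables (R : realType) (n : nat) (Gamma : set (rigid_motion R n)).
Hypothesis Gamma_group : group_closed (mem Gamma).
Notation Lambda := (translation_lattice Gamma).

Lemma Gamma1 : Gamma 1%g.
Proof. by case: Gamma_group => /set_mem. Qed.

Lemma GammaM g h : Gamma g -> Gamma h -> Gamma (g * h)%g.
Proof.
move=> Gg Gh; apply: set_mem.
by apply: (group_closedM Gamma_group); apply: mem_set.
Qed.

Lemma GammaV g : Gamma g -> Gamma g^-1%g.
Proof.
by move=> Gg; apply: set_mem; apply: (group_closedV Gamma_group); apply: mem_set.
Qed.

Lemma translation_eq (g : rigid_motion R n) : linear_part g = 1%:M ->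
  g = translation (translation_part g).
Proof. by move=> g1; apply: rm_eq. Qed.

Lemma Lambda0 : Lambda 0.
Proof. by rewrite /translation_lattice /=; have := Gamma1; congr Gamma; apply: rm_eq. Qed.

Lemma LambdaD v w : Lambda v -> Lambda w -> Lambda (v + w).
Proof.
move=> Lv Lw; have := GammaM Lv Lw; congr Gamma; apply: rm_eq.
  exact: mulmx1.
by rewrite /translation_part /= mul1mx addrC.
Qed.

Lemma LambdaN v : Lambda v -> Lambda (- v).
Proof.
move=> Lv; have := GammaV Lv; congr Gamma; apply: rm_eq.
  exact: trmx1.
by rewrite /translation_part /= /linear_part /= trmx1 mul1mx.
Qed.

Lemma LambdaMz v (m : int) : Lambda v -> Lambda (v *~ m).
Proof.
move=> Lv; have Ln k : Lambda (v *+ k).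
  by elim: k => [|k IH]; [exact: Lambda0 | rewrite mulrS; exact: LambdaD].
by case: m => k; [exact: Ln | rewrite NegzE mulrNz; apply/LambdaN/Ln].
Qed.

Lemma Lambda_sum (I : finType) (v : I -> 'cV[R]_n) :
  (forall i, Lambda (v i)) -> Lambda (\sum_i v i).
Proof. by move=> Lv; elim/big_ind: _ => //; [exact: Lambda0 | exact: LambdaD]. Qed.

Lemma Lambda_holonomy B v : holonomy Gamma B -> Lambda v -> Lambda (B *m v).
Proof.
case=> g Gg <- Lv; rewrite /translation_lattice /= -translation_conj.
exact: GammaM (GammaM Gg Lv) (GammaV Gg).
Qed.

Lemma Lambda_sub g h : Gamma g -> Gamma h -> linear_part g = linear_part h ->
  Lambda (translation_part g - translation_part h).
Proof.
move=> Gg Gh gh; have := GammaM Gg (GammaV Gh); congr Gamma; apply: rm_eq.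
  by rewrite -[RHS](linear_partVr h) -{1}gh.
rewrite {1}/translation_part /= [LHS]addrC; congr (_ + _).
by rewrite /translation_part /= mulmxN mulmxA gh linear_partVr mul1mx.
Qed.

Lemma holonomyM B C : holonomy Gamma B -> holonomy Gamma C -> holonomy Gamma (B *m C).
Proof. by move=> [g Gg <-] [h Gh <-]; exists (g * h)%g => //; exact: GammaM. Qed.

Lemma holonomy1 : holonomy Gamma 1%:M.
Proof. by exists 1%g => //; exact: Gamma1. Qed.

Lemma holonomyT B : holonomy Gamma B -> holonomy Gamma B^T.
Proof. by move=> [g Gg <-]; exists g^-1%g => //; exact: GammaV. Qed.

Lemma holonomyVr B : holonomy Gamma B -> B *m B^T = 1%:M.
Proof. by move=> [g Gg <-]; exact: linear_partVr. Qed.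

Lemma holonomyVl B : holonomy Gamma B -> B^T *m B = 1%:M.
Proof. by move=> [g Gg <-]; exact: linear_partVl. Qed.

Section Spanning.
Hypothesis Gamma_cocompact : cocompact Gamma.

(** An invariant continuous function descends to the compact orbit space. *)
Lemma invariant_bounded (f : rigid_motion R n -> R) : continuous f ->
  (forall g x, Gamma g -> f (g * x)%g = f x) -> exists M, forall x, f x <= M.
Proof.
move=> cf finv; pose Q := quotient_topology {eq_quot (same_orbit Gamma)}%qT.
have fE x y : x = y %[mod_eq (same_orbit_equiv Gamma)]%qT -> f x = f y.
  move=> /eqmodP /asboolP Gxy.
  have : orbit_set Gamma x x by exists 1%g; [exact: Gamma1 | rewrite mul1g].
  by rewrite Gxy => -[g Gg <-]; rewrite finv.
have cq : continuous (f \o repr : Q -> R).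
  apply: repr_comp_continuous => //.
  by move=> x y /eqP xy; apply/eqP; apply: fE.
have : compact [set (f \o (repr : Q -> _)) x | x in [set: Q]].
  by apply: continuous_compact => //; exact: continuous_subspaceT.
move=> /(@compact_bounded _ R^o) [M [_ /(_ (M + 1))]].
move=> Mb; exists (M + 1) => x; apply: le_trans (ler_norm _) _.
apply: Mb; first by rewrite ltrDl.
exists (\pi_Q x)%qT => //=; apply: fE; by rewrite reprK.
Qed.

Lemma sum_continuous (T : topologicalType) (I : Type) (r : seq I) (F : I -> T -> R) :
  (forall i, continuous (F i)) -> continuous (fun x => \sum_(i <- r) F i x).
Proof.
move=> cF; rewrite -fct_sumE; elim/big_ind: _ => //.
  exact: cst_continuous.
by move=> f g cf cg x; apply: cvgD; [exact: cf | exact: cg].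
Qed.

Lemma affine_combination_continuous (T : topologicalType) (I : Type) (r : seq I)
    (l : I -> R) (c : R) (F : I -> T -> R) :
  (forall i, continuous (F i)) ->
  continuous (fun x => \sum_(i <- r) l i * F i x + c).
Proof.
move=> cF x; apply: cvgD; last exact: cvg_cst.
apply: (sum_continuous (F := fun i x => l i * F i x)) => i y.
by apply: cvgM; [exact: cvg_cst | exact: cF].
Qed.

Lemma affine_form_continuous (l : 'rV[R]_n) (c : R) :
  continuous (fun x : rigid_motion R n => (l *m translation_part x) 0 0 + c).
Proof.
have ct (i : 'I_n) : continuous (fun x : rigid_motion R n => translation_part x i 0).
  move=> x; rewrite /translation_part.
  apply: (@continuous_comp _ _ _ (@rm_pair R n) (fun p => p.2 i 0)).
    exact: initial_continuous.
  apply: (@continuous_comp _ _ _ snd (fun v : 'cV[R]_n => v i 0)); first exact: cvg_snd.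
  exact: coord_continuous.
by under eq_fun do rewrite mxE; exact: affine_combination_continuous.
Qed.

(** If [w] is perpendicular to all lattice vectors, then the [w]-component of the
    translation part of a group element depends only on its linear part.  Summing
    [(w . g a) ^ 2] over one element [g] for each holonomy matrix thus gives an
    invariant function of the translation part [a] of a motion.  It is unbounded
    along multiples of [w] unless [w] vanishes. *)
Lemma translation_lattice_spans (w : 'cV[R]_n) : finite_set (holonomy Gamma) ->
  (forall v, Lambda v -> w^T *m v = 0) -> w = 0.
Proof.
move=> finG wL.
pose lift B : rigid_motion R n := xget 1%g [set g | Gamma g /\ linear_part g = B].
have liftP B : holonomy Gamma B -> Gamma (lift B) /\ linear_part (lift B) = B.
  by move=> [g Gg gB]; rewrite /lift; case: xgetP => [h -> //|/(_ g)[]].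
pose h B (a : 'cV[R]_n) : R :=
  ((w^T *m B *m a) 0 0 + (w^T *m translation_part (lift B)) 0 0) ^+ 2.
pose f (x : rigid_motion R n) := \sum_(B \in holonomy Gamma) h B (translation_part x).
have wlift g : Gamma g ->
    w^T *m translation_part g = w^T *m translation_part (lift (linear_part g)).
  move=> Gg; have [Gl lE] := liftP _ (imageP linear_part Gg).
  apply/eqP; rewrite -subr_eq0 -mulmxBr; apply/eqP/wL.
  exact: Lambda_sub.
(* Right multiplication by the linear part of [g] permutes the summands. *)
have [||M fM] := @invariant_bounded f.
- rewrite /f; under eq_fun do rewrite (fsbig_finite _ _ finG).
  apply: sum_continuous => B x.
  have -> : (fun x : rigid_motion R n => h B (translation_part x)) =
      (fun c => c ^+ 2) \o (fun x : rigid_motion R n =>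
        (w^T *m B *m translation_part x) 0 0 +
        (w^T *m translation_part (lift B)) 0 0) by [].
  apply: continuous_comp; first exact: affine_form_continuous.
  exact: exprn_continuous.
- move=> g x Gg; rewrite /f.
  pose C := linear_part g; have HC : holonomy Gamma C by exists g.
  rewrite [RHS](reindex_fsbig (fun B => B *m C) (holonomy Gamma) (holonomy Gamma)).
    apply: eq_fsbigr => B /set_mem HB; rewrite /h; congr (_ ^+ 2).
    have [GB EB] := liftP B HB.
    have := wlift _ (GammaM GB Gg).
    have lE : linear_part (lift B * g)%g = B *m C.
      by transitivity (linear_part (lift B) *m C) => //; rewrite EB.
    have tE : translation_part (lift B * g)%g =
        B *m translation_part g + translation_part (lift B).
      transitivity (linear_part (lift B) *m translation_part g +
        translation_part (lift B)) => //; by rewrite EB.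
    rewrite lE tE.
    move=> <-.
    rewrite (_ : translation_part (g * x)%g =
      C *m translation_part x + translation_part g) //.
    by rewrite !mulmxDr !mulmxA !mxE; ring.
  split=> [B HB|B B' _ _ BB'|B HB].
  - exact: holonomyM.
  - by rewrite -[B]mulmx1 -(holonomyVr HC) mulmxA BB' -mulmxA (holonomyVr HC) mulmx1.
  - exists (B *m C^T); first by apply: holonomyM => //; exact: holonomyT.
    by rewrite -mulmxA (holonomyVl HC) mulmx1.
pose q := (w^T *m w) 0 0.
have qE : q = \sum_i w i 0 ^+ 2.
  by rewrite /q mxE; apply: eq_bigr => i _; rewrite mxE expr2.
have q0 : 0 <= q by rewrite qE; apply: sumr_ge0 => i _; exact: sqr_ge0.
have fq t : (t * q) ^+ 2 <= M.
  apply: le_trans (fM (translation (t *: w))).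
  rewrite /f (fsbigD1 1%:M) //=; last exact: holonomy1.
  have [G1 E1] := liftP _ holonomy1.
  rewrite {1}/h wL ?mulmx1; last first.
    by have := Lambda_sub G1 Gamma1 E1; rewrite subr0.
  rewrite [X in _ <= X + _](_ : _ = (t * q) ^+ 2); last first.
    by rewrite /translation_part /= -scalemxAr !mxE addr0 /q mxE.
  by rewrite lerDl; apply: fsumr_ge0 => B _; exact: sqr_ge0.
have {}q0 : q = 0.
  apply/eqP; apply: contrapT => /negP qN.
  have M0 : 0 <= M by have := fq 0; rewrite mul0r expr0n.
  (* A multiple of [w] far enough to exceed the bound, as [(M + 1) ^+ 2 > M]. *)
  have := fq ((M + 1) / q); rewrite divfK //; nra.
apply/matrixP => i j; rewrite ord1 mxE; apply/eqP; rewrite -sqrf_eq0.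
move: q0; rewrite qE => /eqP; rewrite psumr_eq0 => [/allP/(_ i)|k _]; last exact: sqr_ge0.
by rewrite mem_index_enum => /(_ isT).
Qed.

End Spanning.

Lemma discrete_line (v : 'cV[R]_n) : discrete_subset Gamma ->
  exists2 d : R, 0 < d & forall t, `|t| < d -> Lambda (t *: v) -> t *: v = 0.
Proof.
move=> /(_ _ Gamma1) [_ [V V1 VG]].
have ct : continuous (fun t : R => translation (t *: v) : rigid_motion R n).
  apply: continuous_comp_initial.
  have pc : continuous (fun t : R => (1%:M, t *: v) : 'M[R]_n * 'cV[R]_n).
    move=> t; apply: (@cvg_pair _ _ _ (nbhs t) (nbhs (1%:M : 'M[R]_n)) (nbhs (t *: v))
      _ _ _ (fun=> 1%:M) (fun t => t *: v)); first exact: cvg_cst.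
    exact: scalel_continuous.
  exact: pc.
have t0 : translation (0 *: v) = 1%g by apply: rm_eq => //; exact: scale0r.
have V0 : nbhs (translation (0 *: v)) V by rewrite t0.
have /nbhs_ballP [d d0 dV] := ct 0 V V0; exists d => // t td Lt.
have : (V `&` Gamma) (translation (t *: v)).
  by split=> //; apply: dV; rewrite /ball /= sub0r normrN.
by rewrite VG => /(congr1 translation_part).
Qed.

(** The infimum of the positive elements is attained and divides the others. *)
Lemma discrete_subgroup_cyclic (L : set R) (d s : R) :
  (forall x y, L x -> L y -> L (x - y)) -> 0 < d ->
  (forall x, L x -> `|x| < d -> x = 0) -> L s -> s != 0 ->
  exists t, [/\ L t, t != 0 & forall x, L x -> x / t \is a Num.int].
Proof.
move=> LB d0 Ld Ls s0.
have L0 : L 0 by rewrite -(subrr s); exact: LB.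
have LN x : L x -> L (- x) by move=> Lx; rewrite -sub0r; exact: LB.
have LD x y : L x -> L y -> L (x + y) by move=> Lx Ly; rewrite -[y]opprK; apply/LB/LN.
pose S := [set x | L x /\ 0 < x].
have Sabs : S `|s|.
  by split; [case: (ger0P s) => _ //; exact: LN | rewrite normr_gt0].
have Slb : lbound S 0 by move=> x [_ /ltW].
have Sinf : has_inf S by split; [exists `|s| | exists 0].
have [t [Lt t0] tlt] := inf_adherent d0 Sinf.
have tmin x : S x -> t <= x.
  move=> Sx; rewrite leNgt; apply/negP => xt; have [Lx x0] := Sx.
  have xinf : inf S <= x by apply: ge_inf Sx; exists 0.
  have := Ld _ (LB _ _ Lt Lx); rewrite ger0_norm ?subr_ge0 ?(ltW xt) //.
  move=> /(_ _)/eqP; rewrite subr_eq0 => te.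
  suff /te/eqP tx : t - x < d by rewrite tx ltxx in xt.
  by lra.
exists t; split; rewrite ?gt_eqF // => x Lx.
pose m := Num.floor (x / t).
have Lm k : L (t *~ k).
  have Ln j : L (t *+ j).
    by elim: j => [|j IH]; [rewrite mulr0n | rewrite mulrS; exact: LD].
  by case: k => j; [exact: Ln | rewrite NegzE mulrNz; exact/LN/Ln].
have mx : m%:~R <= x / t by exact: floor_le.
have xm : x / t < (m + 1)%:~R by exact: floorD1_gt.
rewrite ler_pdivlMr // in mx; rewrite ltr_pdivrMr // intrD mulrDl mul1r in xm.
have Lxm := LB _ _ Lx (Lm m); rewrite -mulrzl in Lxm.
have [xm0|xm0] := ltrP 0 (x - m%:~R * t).
  by have := tmin _ (conj Lxm xm0); lra.
by rewrite (_ : x = m%:~R * t) ?mulfK ?gt_eqF ?intr_int //; lra.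
Qed.

End RigidMotionGroups.

(** * Commuting involutions and families of sign patterns *)

Section LinearAlgebra.
Local Open Scope ring_scope.

(** The minimal polynomial divides [('X - 1) * ('X + 1)]. *)
Lemma involution_diagonalizable (F : fieldType) n (A : 'M[F]_n) :
  (2 : F) != 0 -> A *m A = 1%:M -> diagonalizable A.
Proof.
move=> two; case: n A => [|n] A AA.
  exists 1%:M; first exact: unitmx1.
  by rewrite /(_ ~__ {in _}); apply/is_diag_mxP => -[].
apply/diagonalizableP; exists [:: 1; -1].
  by rewrite /= inE andbT -subr_eq0 opprK.
rewrite !big_cons big_nil mulr1 polyCN opprK -subr_sqr expr1n.
apply: mxminpoly_min; rewrite rmorphB rmorph1 rmorphXn /= horner_mx_X expr2.
by rewrite -[A * A]/(A *m A) AA subrr.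
Qed.

Lemma eigenrow_involution (F : fieldType) n (A : 'M[F]_n) (p : 'rV_n) (d : F) :
  A *m A = 1%:M -> p *m A = d *: p -> p *m A = p \/ p *m A = - p.
Proof.
move=> AA pA; have : (d ^+ 2 - 1) *: p = 0.
  by rewrite scalerBl scale1r expr2 -scalerA -{1}pA scalemxAl -pA -mulmxA AA mulmx1 subrr.
move/eqP; rewrite scaler_eq0 => /orP[|/eqP ->]; last by rewrite mul0mx; left.
rewrite subr_sqr_1 mulf_eq0 => /orP[]; rewrite ?subr_eq0 ?addr_eq0 => /eqP d1.
  by left; rewrite pA d1 scale1r.
by right; rewrite pA d1 scaleN1r.
Qed.

Lemma codiagonalize_involutions (F : fieldType) n (As : seq 'M[F]_n) :
  (2 : F) != 0 -> {in As, forall A, A *m A = 1%:M} ->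
  {in As &, forall A B, A *m B = B *m A} ->
  exists2 P : 'M[F]_n, P \in unitmx &
    {in As, forall A i, row i P *m A = row i P \/ row i P *m A = - row i P}.
Proof.
move=> two inv com.
have [|P Pu /allP PAs] := (codiagonalizableP As).1.
  by split=> // A AAs; exact: involution_diagonalizable (inv A AAs).
exists P => // A AAs i; have /diagonalizable_forPex [D /(simmxP Pu) PA] := PAs A AAs.
apply: (@eigenrow_involution _ _ _ _ (D 0 i)); first exact: inv.
by rewrite -row_mul PA row_mul row_diag_mx -scalemxAl -rowE.
Qed.

(** [N] and the family of complements of its members fill the power set. *)
Lemma complement_family (n : nat) (N : {set {set 'I_n}}) : (0 < n)%N ->
  #|N| = (2 ^ n.-1)%N -> (forall A, A \in N -> ~: A \notin N) ->
  forall A, A \in N \/ ~: A \in N.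
Proof.
move=> n0 cN NC A.
have CN : [disjoint N & [set ~: B | B in N]].
  apply/pred0P => B /=; apply/negP => /andP[BN /imsetP[C CN BC]].
  by move: (NC C CN); rewrite -BC BN.
have : N :|: [set ~: B | B in N] == [set: {set 'I_n}].
  rewrite eqEcard finset.subsetT -powersetT card_powerset cardsT card_ord.
  have /eqP -> : #|N :|: [set ~: B | B in N]| == (#|N| + #|[set ~: B | B in N]|)%N.
    by rewrite (leq_card_setU N [set ~: B | B in N]).2.
  rewrite card_imset; last exact: (can_inj (@finset.setCK _)).
  by rewrite cN addnn -mul2n -expnS (prednK n0) leqnn.
move/eqP/setP/(_ A); rewrite !inE => /orP[AN|/imsetP[B BN ->]]; first by left.
by right; rewrite finset.setCK.
Qed.

End LinearAlgebra.

(** * The eigenframe of a holonomy group isomorphic to Z_2 ^ (n - 1) *)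

Section GHWGroups.
Local Open Scope ring_scope.
Variables (R : realType) (n : nat) (Gamma : set (rigid_motion R n)).
Hypothesis n_gt0 : (0 < n)%N.
Hypothesis Gamma_group : group_closed (mem Gamma).
Hypothesis Gamma_torsion_free : torsion_free Gamma.
Hypothesis Gamma_discrete : discrete_subset Gamma.
Hypothesis Gamma_cocompact : cocompact Gamma.
Notation Lambda := (translation_lattice Gamma).

Section Holonomy.
Variable phi : 'rV['F_2]_(n.-1) -> 'M[R]_n.
Hypothesis phi_bij : set_bij [set: 'rV['F_2]_(n.-1)]%classic (holonomy Gamma) phi.
Hypothesis phiD : {morph phi : u v / u + v >-> u *m v}.

Lemma phi_holonomy u : holonomy Gamma (phi u).
Proof. by case: phi_bij => fun_phi _ _; exact: fun_phi. Qed.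

Lemma phi_onto B : holonomy Gamma B -> exists u, phi u = B.
Proof. by case: phi_bij => _ _ /[apply] -[u _ <-]; exists u. Qed.

Lemma phi_inj : injective phi.
Proof. by move=> u v; case: phi_bij => _ + _; apply; rewrite in_setT. Qed.

Lemma finite_holonomy : finite_set (holonomy Gamma).
Proof.
have : finite_set (phi @` [set: _]%classic)%classic by apply/finite_image/finite_finset.
by apply: sub_finite_set => B /phi_onto[u <-]; exists u.
Qed.

Lemma holonomy_comm B C : holonomy Gamma B -> holonomy Gamma C -> B *m C = C *m B.
Proof. by move=> /phi_onto[u <-] /phi_onto[v <-]; rewrite -!phiD addrC. Qed.

Lemma holonomy_inv B : holonomy Gamma B -> B *m B = 1%:M.
Proof.
move=> /phi_onto[u <-].
have u2 : u + u = 0.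
  by apply/rowP => i; rewrite !mxE; apply/val_inj; case: (u 0 i) => [[|[|]]].
have phi00 : phi 0 *m phi 0 = phi 0 by rewrite -phiD addr0.
by rewrite -phiD u2 -[LHS]mul1mx -(holonomyVl (phi_holonomy 0)) -mulmxA phi00.
Qed.

Lemma holonomy_sym B : holonomy Gamma B -> B^T = B.
Proof.
by move=> HB; rewrite -[LHS]mulmx1 -(holonomy_inv HB) mulmxA (holonomyVl HB) mul1mx.
Qed.

(** The square of such an element is the identity. *)
Lemma holonomy_antipode g : Gamma g ->
  linear_part g *m translation_part g = - translation_part g -> g = 1%g.
Proof.
move=> Gg gt; apply: (Gamma_torsion_free (k := 2)) => //; rewrite expgS expg1.
apply: rm_eq; first by apply: holonomy_inv; exists g.
rewrite -[LHS]/(linear_part g *m translation_part g + translation_part g).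
by rewrite gt addNr.
Qed.

Lemma holonomy_frame : exists2 P : 'M[R]_n, P \in unitmx &
  forall B i, holonomy Gamma B -> row i P *m B = row i P \/ row i P *m B = - row i P.
Proof.
have [|A|A B|P Pu PB] :=
  @codiagonalize_involutions R n [seq phi u | u : 'rV['F_2]_(n.-1)].
- by rewrite pnatr_eq0.
- by move=> /mapP[u _ ->]; exact/holonomy_inv/phi_holonomy.
- by move=> /mapP[u _ ->] /mapP[v _ ->]; apply: holonomy_comm; exact: phi_holonomy.
exists P => // B i /phi_onto[u <-]; apply: PB; apply/mapP; exists u => //.
by rewrite mem_enum.
Qed.

Section Frame.
Variable P : 'M[R]_n.
Hypothesis P_unit : P \in unitmx.
Hypothesis P_eigen : forall B i, holonomy Gamma B ->
  row i P *m B = row i P \/ row i P *m B = - row i P.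

Definition negated (B : 'M[R]_n) : {set 'I_n} := [set i | row i P *m B == - row i P].

Lemma row_P_neq0 i : row i P != 0.
Proof.
apply/eqP => Pi0; have : row i (P *m invmx P) = 0 by rewrite row_mul Pi0 mul0mx.
by rewrite mulmxV // => /rowP/(_ i)/eqP; rewrite !mxE eqxx oner_eq0.
Qed.

Lemma row_P_neqN i : row i P != - row i P.
Proof.
by rewrite -subr_eq0 opprK -mulr2n -scaler_nat scaler_eq0 pnatr_eq0 row_P_neq0.
Qed.

Lemma row_sign B i : holonomy Gamma B ->
  row i P *m B = sign_at R (negated B) i *: row i P.
Proof.
move=> HB; rewrite /sign_at inE; case: eqP => [->|BN]; first by rewrite scaleN1r.
by rewrite scale1r; case: (P_eigen i HB).
Qed.

Lemma col_sign B i : holonomy Gamma B ->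
  B *m (row i P)^T = sign_at R (negated B) i *: (row i P)^T.
Proof.
move=> HB; apply: trmx_inj.
by rewrite trmx_mul trmxK holonomy_sym // row_sign // !linearZ /= trmxK.
Qed.

Lemma negated_inj B C : holonomy Gamma B -> holonomy Gamma C ->
  negated B = negated C -> B = C.
Proof.
move=> HB HC BC; rewrite -[B](mulKmx P_unit) -[C](mulKmx P_unit); congr (_ *m _).
by apply/row_matrixP => i; rewrite !row_mul !row_sign // BC.
Qed.

Lemma negatedM B C : holonomy Gamma B -> holonomy Gamma C ->
  negated (B *m C) = symdiff (negated B) (negated C).
Proof.
move=> HB HC; apply/setP => i.
rewrite [in LHS]inE mulmxA !row_sign // -scalemxAl row_sign //.
rewrite [RHS]inE /sign_at; have := negbTE (row_P_neqN i).
case: (i \in negated B); case: (i \in negated C) => /= PN;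
by rewrite ?expr1 ?expr0 ?scaleN1r ?scale1r ?opprK ?eqxx.
Qed.

Lemma negated1 : negated 1%:M = finset.set0.
Proof. by apply/setP => i; rewrite !inE mulmx1; exact/negbTE/row_P_neqN. Qed.

(** A motion with linear part -1 has trivial square. *)
Lemma negated_setT B : holonomy Gamma B -> negated B != [set: 'I_n].
Proof.
move=> [g Gg <-]; apply/eqP => gT; have HB : holonomy Gamma (linear_part g) by exists g.
have gN : linear_part g = - 1%:M.
  rewrite -[LHS](mulKmx P_unit) -[RHS](mulKmx P_unit); congr (_ *m _).
  apply/row_matrixP => i; rewrite !row_mul row_sign // gT sign_at_in ?inE //.
  by rewrite mulmxN mulmx1 scaleN1r.
have g1 : g = 1%g by apply: holonomy_antipode; rewrite // gN mulNmx mul1mx.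
by move: gT; rewrite g1 negated1 => /setP/(_ (Ordinal n_gt0)); rewrite !inE.
Qed.

(** The holonomy group has index two in the group of all sign matrices and does
    not contain -1, so it represents every sign matrix up to sign. *)
Lemma holonomy_reflection (N : {set 'I_n}) : exists2 B, holonomy Gamma B &
  negated B = N \/ negated B = ~: N.
Proof.
pose F := [set negated (phi u) | u in [set: 'rV['F_2]_(n.-1)]].
have FP A : A \in F -> exists2 B, holonomy Gamma B & negated B = A.
  by case/imsetP => u _ ->; exists (phi u) => //; exact: phi_holonomy.
have cF : #|F| = (2 ^ n.-1)%N.
  rewrite card_imset ?cardsT ?card_mx ?mul1n ?card_Fp // => u v uv.
  by apply/phi_inj/negated_inj => //; exact: phi_holonomy.
have NF A : A \in F -> ~: A \notin F.
  move=> /FP[B HB BA]; apply/negP => /FP[C HC CA].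
  have /eqP[] := negated_setT (holonomyM Gamma_group HB HC).
  by rewrite negatedM // BA CA; apply/setP => i; rewrite !inE; case: (i \in A).
by have [/FP[B HB BN]|/FP[B HB BN]] := complement_family n_gt0 cF NF N;
  exists B => //; [left | right].
Qed.

(** Eigenvectors of a symmetric matrix for different eigenvalues: the involution
    that negates only axis [i], or fixes only axis [i], separates [i] from [j]. *)
Lemma frame_orthogonal i j : i != j -> row i P *m (row j P)^T = 0.
Proof.
move=> ij; have [B HB Bi] := holonomy_reflection [set i].
have : row i P *m B *m (row j P)^T = row i P *m (B *m (row j P)^T) by rewrite mulmxA.
rewrite row_sign // col_sign // -scalemxAl -scalemxAr => /eqP.
rewrite -subr_eq0 -scalerBl scaler_eq0 => /orP[|/eqP //].
rewrite /sign_at => /eqP sij; exfalso; move: sij.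
by case: Bi => ->; rewrite !inE eqxx [j == i]eq_sym (negbTE ij) /= ?expr1 ?expr0; lra.
Qed.

Lemma frame_norm_neq0 i : (row i P *m (row i P)^T) 0 0 != 0.
Proof.
apply: contra (row_P_neq0 i); rewrite mxE.
under eq_bigr do rewrite [in X in _ * X]mxE -expr2.
rewrite psumr_eq0 => [/allP Pi0|j _]; last exact: sqr_ge0.
apply/eqP/rowP => j; have := Pi0 j (mem_index_enum j).
by rewrite /= sqrf_eq0 [in RHS]mxE => /eqP.
Qed.

Lemma frame_ext (v w : 'cV[R]_n) :
  (forall i, (row i P *m v) 0 0 = (row i P *m w) 0 0) -> v = w.
Proof.
move=> vw; rewrite -[v](mulKmx P_unit) -[w](mulKmx P_unit); congr (_ *m _).
apply/row_matrixP => i; rewrite !row_mul; apply/matrixP => a b; rewrite !ord1; exact: vw.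
Qed.

(** Twice the projection to axis [i] of a lattice vector [v] is [v - B v] or
    [v + B v], for the involution [B] that negates or fixes only axis [i]. *)
Lemma lattice_meets_axis i : exists2 s : R, s != 0 & Lambda (s *: (row i P)^T).
Proof.
have [v Lv vi] : exists2 v, Lambda v & row i P *m v != 0.
  apply: contrapT => nv; have /eqP := row_P_neq0 i; case.
  apply: trmx_inj; rewrite trmx0.
  apply: (translation_lattice_spans Gamma_group Gamma_cocompact finite_holonomy) => v Lv.
  by rewrite trmxK; apply: contrapT => /eqP vi; apply: nv; exists v.
have [B HB Bi] := holonomy_reflection [set i].
have [u Lu uE] : exists2 u, Lambda u &
    forall j, row j P *m u = (if j == i then 2 *: (row j P *m v) else 0).
  have LBv := Lambda_holonomy Gamma_group HB Lv.
  case: Bi => Bi.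
    exists (v - B *m v) => [|j]; first by apply: LambdaD => //; exact: LambdaN.
    rewrite mulmxBr mulmxA row_sign // Bi -scalemxAl /sign_at inE.
    by case: eqP => _; rewrite /= ?expr1 ?scaleN1r ?opprK ?scale1r ?subrr // scaler_nat.
  exists (v + B *m v) => [|j]; first exact: LambdaD.
  rewrite mulmxDr mulmxA row_sign // Bi -scalemxAl /sign_at !inE.
  by case: eqP => _; rewrite /= ?expr1 ?expr0 ?scaleN1r ?scale1r ?subrr // scaler_nat.
pose s := 2 * (row i P *m v) 0 0 / (row i P *m (row i P)^T) 0 0.
exists s.
  rewrite !mulf_neq0 ?invr_eq0 ?frame_norm_neq0 ?pnatr_eq0 //.
  by apply: contraNneq vi => vi; apply/eqP/matrixP => a b; rewrite !ord1 vi mxE.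
rewrite (_ : s *: _ = u) //; apply: frame_ext => j.
rewrite uE -scalemxAr [LHS]mxE; case: eqVneq => [->|ji].
  by rewrite divfK ?frame_norm_neq0 // [RHS]mxE.
by rewrite frame_orthogonal // mxE mulr0.
Qed.

Lemma axis_generator i : exists t : R, [/\ Lambda (t *: (row i P)^T), t != 0 &
  forall x, Lambda (x *: (row i P)^T) -> x / t \is a Num.int].
Proof.
have [s s0 Ls] := lattice_meets_axis i.
have [d d0 dL] := discrete_line Gamma_group (row i P)^T Gamma_discrete.
apply: (@discrete_subgroup_cyclic R (fun t => Lambda (t *: (row i P)^T)) d s) => //.
- by move=> x y Lx Ly; rewrite scalerBl; apply: LambdaD => //; exact: LambdaN.
- move=> x Lx xd; have /eqP := dL x xd Lx; rewrite scaler_eq0 => /orP[/eqP //|].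
  by rewrite -trmx0 (inj_eq trmx_inj) (negbTE (row_P_neq0 i)).
Qed.

Section Coordinates.
Variable t : 'I_n -> R.
Hypothesis t_generator : forall i, [/\ Lambda (t i *: (row i P)^T), t i != 0 &
  forall x, Lambda (x *: (row i P)^T) -> x / t i \is a Num.int].

Definition axis_vector (i : 'I_n) : 'cV[R]_n := t i *: (row i P)^T.

Definition coordinate (i : 'I_n) (v : 'cV[R]_n) : R :=
  (row i P *m v) 0 0 / (row i P *m axis_vector i) 0 0.

Lemma axis_vector_orthogonal i j : i != j -> row i P *m axis_vector j = 0.
Proof. by move=> ij; rewrite -scalemxAr frame_orthogonal // scaler0. Qed.

Lemma axis_norm_neq0 i : (row i P *m axis_vector i) 0 0 != 0.
Proof.
rewrite -scalemxAr mxE mulf_neq0 ?frame_norm_neq0 //; by case: (t_generator i).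
Qed.

Lemma coordinate_sum (c : 'I_n -> R) i : coordinate i (\sum_j c j *: axis_vector j) = c i.
Proof.
rewrite /coordinate mulmx_sumr (bigD1 i) //= big1 ?addr0 => [|j ji].
  by rewrite -scalemxAr [in X in X / _]mxE mulfK // axis_norm_neq0.
by rewrite -scalemxAr axis_vector_orthogonal ?scaler0 // eq_sym.
Qed.

Lemma coordinate_ext v w : (forall i, coordinate i v = coordinate i w) -> v = w.
Proof.
move=> vw; apply: frame_ext => i.
by apply: (divIf (axis_norm_neq0 i)); exact: vw.
Qed.

Lemma coordinateE v : v = \sum_i coordinate i v *: axis_vector i.
Proof. by apply: coordinate_ext => i; rewrite coordinate_sum. Qed.

Lemma coordinateD i v w : coordinate i (v + w) = coordinate i v + coordinate i w.
Proof. by rewrite /coordinate mulmxDr mxE mulrDl. Qed.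

Lemma coordinateN i v : coordinate i (- v) = - coordinate i v.
Proof. by rewrite /coordinate mulmxN mxE mulNr. Qed.

Lemma coordinate_holonomy B i v : holonomy Gamma B ->
  coordinate i (B *m v) = sign_at R (negated B) i * coordinate i v.
Proof.
by move=> HB; rewrite /coordinate mulmxA row_sign // -scalemxAl [in LHS]mxE mulrA.
Qed.

(** [Gamma] in the coordinates of the axis generators. *)
Definition diagonal_model (N : {set 'I_n}) (b : 'I_n -> R) : Prop :=
  exists2 g, Gamma g & negated (linear_part g) = N /\
    forall i, coordinate i (translation_part g) = b i.

Lemma diagonal_model_lattice v : Lambda v ->
  diagonal_model finset.set0 (fun i => coordinate i v).
Proof. by move=> Lv; exists (translation v) => //; split=> //; exact: negated1. Qed.

Lemma lattice_diagonal_model b : diagonal_model finset.set0 b ->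
  Lambda (\sum_i b i *: axis_vector i).
Proof.
move=> [g Gg [g0 gb]].
have g1 : linear_part g = 1%:M.
  apply: negated_inj; [by exists g | exact: holonomy1 | by rewrite g0 negated1].
have -> : \sum_i b i *: axis_vector i = translation_part g.
  by apply: coordinate_ext => i; rewrite coordinate_sum gb.
by rewrite /translation_lattice /= -translation_eq.
Qed.

Lemma diagonal_model_torsion_free : diagonal_torsion_free diagonal_model.
Proof.
have hol g : Gamma g -> holonomy Gamma (linear_part g) by move=> Gg; exists g.
split.
- move=> N b M c [g Gg [<- gb]] [h Gh [<- hc]]; exists (g * h)%g; first exact: GammaM.
  have [HB HC] := (hol g Gg, hol h Gh); split; first exact: negatedM.
  by move=> i; rewrite -gb -hc -coordinate_holonomy // -coordinateD.
- move=> N b [g Gg [<- gb]]; exists g^-1%g; first exact: GammaV.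
  have HB := hol g Gg; have gT := holonomy_sym HB.
  split; first by rewrite -[in RHS]gT.
  move=> i; rewrite -gb -coordinate_holonomy // -coordinateN.
  by rewrite -[in RHS]gT.
- move=> v vZ; pose w := \sum_i v i *: axis_vector i.
  have Lw : Lambda w.
    apply: Lambda_sum => // i; have /intrP[m ->] := vZ i.
    by rewrite scaler_int; apply: LambdaMz => //; case: (t_generator i).
  have := diagonal_model_lattice Lw; congr diagonal_model.
  by apply: boolp.funext => i; rewrite coordinate_sum.
- move=> v i Lv v0; have := lattice_diagonal_model Lv.
  rewrite (bigD1 i) //= big1 ?addr0 => [|j /v0 ->]; last by rewrite scale0r.
  have [_ ti t_int] := t_generator i.
  by rewrite scalerA => /t_int; rewrite mulfK.
- move=> i; have [B [g Gg gB] [Bi|Bi]] := holonomy_reflection [set i]; [left|right];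
    by exists (fun j => coordinate j (translation_part g)), g => //; rewrite gB Bi.
- move=> N b [g Gg [<- gb]] b0.
  rewrite (_ : g = 1%g) ?negated1 //; apply: holonomy_antipode => //.
  apply: coordinate_ext => i; rewrite coordinate_holonomy; last exact: hol.
  rewrite coordinateN gb.
  have [iN|iN] := boolP (i \in negated (linear_part g)).
    by rewrite sign_at_in // mulN1r.
  by rewrite b0 // mulr0 oppr0.
Qed.

(** By integrality of the coordinates the axis generators are a Z-basis, in which
    the holonomy acts by signs. *)
Lemma frame_diagonal_group : diagonal_group Gamma.
Proof.
have Lint v i : Lambda v -> coordinate i v \is a Num.int.
  move=> /diagonal_model_lattice.
  exact: (lattice_integral diagonal_model_torsion_free).
exists axis_vector; split.
- split.
  + move=> c _; apply: Lambda_sum => // i; apply: LambdaMz => //.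
    by case: (t_generator i).
  + move=> c d _ _ cd; apply/colP => i; apply: (@intr_inj R).
    have sumE (x : 'cV[int]_n) :
        \sum_j axis_vector j *~ x j 0 = \sum_j (x j 0)%:~R *: axis_vector j.
      by apply: eq_bigr => j _; rewrite scaler_int.
    have := congr1 (coordinate i) cd; rewrite /= !sumE.
    rewrite (coordinate_sum (fun j => (c j 0)%:~R)).
    by rewrite (coordinate_sum (fun j => (d j 0)%:~R)).
  move=> v Lv; pose c : 'cV[int]_n := \col_i Num.floor (coordinate i v).
  exists c => //; rewrite [RHS]coordinateE; apply: eq_bigr => i _.
  by rewrite mxE -scaler_int floorK //; exact: Lint.
- move=> i j ij; rewrite {1}/axis_vector [(_ *: _)^T]linearZ /= trmxK.
  by rewrite -scalemxAl axis_vector_orthogonal // scaler0.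
pose rho B : 'M[int]_n := \matrix_(i, j) (((-1) ^+ (i \in negated B)) *+ (i == j)).
exists rho; last first.
  by move=> B _; apply/is_diag_mxP => i j ij; rewrite mxE -val_eqE (negbTE ij).
move=> g Gg j; have HB : holonomy Gamma (linear_part g) by exists g.
rewrite conj_actionE (bigD1 j) //= big1 ?addr0 => [|i ij]; last first.
  by rewrite mxE (negbTE ij) mulr0n mulr0z.
rewrite mxE eqxx mulr1n -scalemxAr col_sign // scalerA mulrC -scalerA /sign_at.
by case: (_ \in _); rewrite /= ?scaleN1r ?scale1r ?expr1 ?mulrN1z.
Qed.

End Coordinates.
End Frame.

Lemma GHW_diagonal : diagonal_group Gamma.
Proof.
have [P P_unit P_eigen] := holonomy_frame.
have [t tP] := choice (axis_generator P_unit P_eigen).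
exact: frame_diagonal_group tP.
Qed.

End Holonomy.
End GHWGroups.

Theorem theorem3p1 (R : realType) (n : nat) (n_gt0 : (0 < n)%N)
    (Gamma : set (rigid_motion R n)) (GHW_Gamma : GHW Gamma) :
  diagonal_group Gamma.
Proof.
case: GHW_Gamma => -[grp tf disc coc] [phi [phi_bij phiD]].
exact: (GHW_diagonal n_gt0 grp tf disc coc phi_bij phiD).
Qed.
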